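(* Let $\mathfrak X$ be a real Fréchet space. Let $\sigma:\mathfrak X\to\mathfrak X$ be continuous, von Neumann-bounded and satisfying the separating property. Assume that for a given compact subset $K\subset\mathfrak X$ and a given regular (real-valued, i.e. signed) Borel measure $\mu$ on $K$ it holds $$\int_K\langle\ell,\sigma(Ax+b)\rangle\,\mu(dx)=0$$ for all $\ell\in\mathfrak X'$, $A\in\mathcal L(\mathfrak X)$, $b\in\mathfrak X$. Then $\mu=0$.
   Context: The topology of $\mathfrak X$ is generated by an increasing sequence of seminorms $(p_k)_{k\in\mathbb N}$. $\mathfrak X'$ is the topological dual of $\mathfrak X$, $\langle\cdot,\cdot\rangle$ the canonical pairing between $\mathfrak X'$ and $\mathfrak X$, and $\mathcal L(\mathfrak X)$ the space of continuous linear operators $\mathfrak X\to\mathfrak X$. $\sigma$ is von Neumann-bounded if its range $\sigma(\mathfrak X)$ is a von Neumann-bounded set, i.e. for every $k\in\mathbb N$ there is $c_k>0$ with $\sup_{x\in\mathfrak X}p_k(\sigma(x))\le c_k$. Separating property of $\sigma$: there exist $\psi\in\mathfrak X'\setminus\{0\}$ and $u_+,u_-,u_0\in\mathfrak X$ such that either $u_+\notin\operatorname{span}\{u_0,u_-\}$ or $u_-\notin\operatorname{span}\{u_0,u_+\}$, and such that $$\lim_{\lambda\to\infty}\sigma(\lambda x)=u_+\ \text{if }x\in\Psi_+,\qquad \lim_{\lambda\to\infty}\sigma(\lambda x)=u_-\ \text{if }x\in\Psi_-,\qquad \lim_{\lambda\to\infty}\sigma(\lambda x)=u_0\ \text{if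 }x\in\Psi_0,$$ where $\Psi_+=\{x\in\mathfrak X:\langle\psi,x\rangle>0\}$, $\Psi_-=\{x\in\mathfrak X:\langle\psi,x\rangle<0\}$ and $\Psi_0=\ker(\psi)$. (''Either ... or'' is not exclusive.) A positive Borel measure $\nu$ on a locally compact space $Y$ is regular if it is finite on compact sets and for every Borel set $E$ one has $\nu(E)=\sup\{\nu(F):F\subset E,\ F\text{ compact}\}$ and $\nu(E)=\inf\{\nu(U):U\supset E,\ U\text{ open}\}$; a signed Borel measure $\nu$ is regular if $|\nu|$ is. *)

(* Defs.v *)
From HB Require Import structures.
From mathcomp Require Import all_boot all_order all_algebra.
From mathcomp Require Import all_classical all_reals all_analysis.

Set Implicit Arguments.
Unset Strict Implicit.
Unset Printing Implicit Defensive.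

Import Order.TTheory GRing.Theory Num.Theory.
Import numFieldNormedType.Exports.

Local Open Scope classical_set_scope.
Local Open Scope ring_scope.

Section frechet.
Context (R : realType) (X : tvsType R).

Record seminorm (q : X -> R) : Prop := {
  seminorm_ge0 : forall x, 0 <= q x ;
  seminormD : forall x y, q (x + y) <= q x + q y ;
  seminormZ : forall (a : R) x, q (a *: x) = `|a| * q x }.

(* Completeness is expressed with differences, not with [completeType]: the
   uniform structure carried by a [tvsType] induces the topology but is not
   required to be translation invariant, so completeness for it would be a
   different notion. *)
Definition tvs_cauchy_seq (u : nat -> X) : Prop :=
  forall U : set X, nbhs 0 U ->
  exists N, forall m n, (N <= m)%N -> (N <= n)%N -> U (u m - u n).

(* X is a Frechet space and its topology is generated by the increasing
   sequence of seminorms p. Since p is increasing, the sets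
   [set y | p k (y - x) < e] are a base of the neighborhoods of x; this base can
   be taken countable, so that sequential completeness is completeness. *)
Record frechet_seminorms (p : nat -> X -> R) : Prop := {
  frechet_seminorm : forall k, seminorm (p k) ;
  frechet_increasing : forall k x, p k x <= p k.+1 x ;
  frechet_nbhsE : forall (x : X) (U : set X), nbhs x U <->
    exists k, exists2 e : R, 0 < e & [set y | p k (y - x) < e] `<=` U ;
  frechet_hausdorff : hausdorff_space X ;
  frechet_complete : forall u, tvs_cauchy_seq u ->
    exists l : X, u n @[n --> \oo] --> l }.

Definition von_neumann_bounded (p : nat -> X -> R) (B : set X) : Prop :=
  forall k, exists2 c : R, 0 < c & forall y, B y -> p k y <= c.

Definition span2 (u v : X) : set X :=
  [set w | exists a b : R, w = a *: u + b *: v].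

Definition separating (sigma : X -> X) : Prop :=
  exists (psi : {scalar X}) (up um u0 : X),
    [/\ continuous psi,
        (psi : X -> R) <> (fun=> 0),
        ~ span2 u0 um up \/ ~ span2 u0 up um &
        [/\ forall x, 0 < psi x -> sigma (l *: x) @[l --> +oo] --> up,
            forall x, psi x < 0 -> sigma (l *: x) @[l --> +oo] --> um &
            forall x, psi x = 0 -> sigma (l *: x) @[l --> +oo] --> u0]].

End frechet.

Section borel.
Context {R : realType} (X : tvsType R).

Definition pointed_tvs : Type := X.

HB.instance Definition _ := Choice.on pointed_tvs.
HB.instance Definition _ := isPointed.Build pointed_tvs (0 : X).

Definition borel := g_sigma_algebraType (@open X : set (set pointed_tvs)).

HB.instance Definition _ := Measurable.on borel.

End borel.

Section signed_measure.
Context d (T : measurableType d) (R : realType).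
Implicit Type mu : {charge set T -> \bar R}.

Lemma hahn_sig mu :
  {PN : set T * set T | hahn_decomposition mu PN.1 PN.2}.
Proof.
by apply: cid; have [P [N h]] := Hahn_decomposition mu; exists (P, N).
Qed.

(* The Jordan parts and the total variation do not depend on the Hahn
   decomposition chosen by hahn_sig (see Hahn_decomposition_uniq). *)
Definition charge_pos mu : {finite_measure set T -> \bar R} :=
  jordan_pos (svalP (hahn_sig mu)).

Definition charge_neg mu : {finite_measure set T -> \bar R} :=
  jordan_neg (svalP (hahn_sig mu)).

Definition total_variation mu : {measure set T -> \bar R} :=
  charge_variation (svalP (hahn_sig mu)).

Definition charge_integral mu (D : set T) (f : T -> R) : R :=
  \int[charge_pos mu]_(x in D) f x - \int[charge_neg mu]_(x in D) f x.

End signed_measure.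

(* For a compact K, which is closed in the Hausdorff spaces considered here,
   the Borel sets of the space K are the Borel sets of X included in K, and a
   signed Borel measure on K is the same as a charge on the Borel sets of X
   that vanishes outside K. This representation also covers K = set0, whereas
   a [measurableType] must be inhabited. *)
Section measures_on.
Context (R : realType) (X : tvsType R) (K : set X).

Definition charge_on (mu : {charge set (borel X) -> \bar R}) : Prop :=
  forall A : set (borel X), measurable A -> mu A = mu (A `&` K).

(* Regularity in the space K: its open sets are the traces U `&` K of the open
   sets U of X, and its compact sets are the compact sets of X included in K. *)
Record regular_measure_on (nu : {measure set (borel X) -> \bar R}) : Prop := {
  regular_fin : forall F : set X, compact F -> F `<=` K -> (nu F < +oo)%E ;
  regular_inner : forall E : set (borel X), measurable E -> E `<=` K ->
    nu E = ereal_sup [set nu F | F in [set F : set X | compact F /\ F `<=` E]] ;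
  regular_outer : forall E : set (borel X), measurable E -> E `<=` K ->
    nu E = ereal_inf
      [set nu (U `&` K) | U in [set U : set X | open U /\ E `<=` U]] }.

Definition regular_charge_on (mu : {charge set (borel X) -> \bar R}) : Prop :=
  charge_on mu /\ regular_measure_on (total_variation mu).

End measures_on.

(* Main.v *)
(* Composing sigma with a functional that is 1 on one of its three limits and 0
   on the other two, and evaluating along the affine maps x |-> n (phi x - t) z,
   dominated convergence shows that mu vanishes on every half-space {phi > t}
   of K. Hence the image of mu under each phi in the dual is zero, and so
   are the integrals of all exp(phi). Exponentials are stable under products,
   so the functions f with int_K f exp(phi) dmu = 0 for all phi form a class
   stable under multiplication by exp(phi), linear combinations and bounded
   pointwise limits, therefore under multiplication by exp(- exp(n^2 (phi - t) - n)),
   by its limit 1_{phi <= t}, and by the indicator of any set in the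
   sigma-algebra of half-spaces. Since the dual separates points, such sets
   separate disjoint compact sets, and regularity of mu concludes. The
   Hahn-Banach theorem is obtained from the fact that a minimal sublinear
   functional is linear. *)
Require Import Defs.
From HB Require Import structures.
From mathcomp Require Import all_boot all_order all_algebra.
From mathcomp Require Import all_classical all_reals all_analysis.
From mathcomp Require Import measurable_realfun.
From mathcomp Require Import ring lra.

Set Implicit Arguments.
Unset Strict Implicit.
Unset Printing Implicit Defensive.

Import Order.TTheory GRing.Theory Num.Theory.
Import numFieldNormedType.Exports.

Local Open Scope classical_set_scope.
Local Open Scope ring_scope.

(** * The Hahn-Banach theorem *)

Section hahn_banach.
Context (R : realType) (X : lmodType R).
Implicit Types (f g q : X -> R) (x y : X).

(** Homogeneity is only an inequality for positive scalars, which is easier to check for infima;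
    applying it to [a^-1] gives the equality of [sublinearZE]. *)
Record sublinear f : Prop := {
  sublinear0 : f 0 = 0 ;
  sublinearD : forall x y, f (x + y) <= f x + f y ;
  sublinearZ : forall (a : R) x, 0 < a -> f (a *: x) <= a * f x }.

Lemma sublinearZE f (a : R) x : sublinear f -> 0 <= a -> f (a *: x) = a * f x.
Proof.
move=> sf; rewrite le_eqVlt => /predU1P[<-|a0].
  by rewrite scale0r mul0r (sublinear0 sf).
apply/eqP; rewrite eq_le (sublinearZ sf)//=.
have ai0 : 0 < a^-1 by rewrite invr_gt0.
have := sublinearZ sf (a *: x) ai0.
rewrite scalerA mulVf ?gt_eqF// scale1r => h.
by rewrite -ler_pdivlMl.
Qed.

Lemma sublinear_ge f x : sublinear f -> - f (- x) <= f x.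
Proof.
move=> sf; have := sublinearD sf x (- x).
by rewrite subrr (sublinear0 sf); lra.
Qed.

(* A sublinear functional below f whose value at - y is at most - f y: a minimal
   f coincides with it, hence is odd. *)
Definition directional f y x : R :=
  inf [set f (x + t *: y) - t * f y | t in [set t : R | 0 <= t]].

Section directional.
Variables (f : X -> R) (sf : sublinear f) (y : X).
Let S x := [set f (x + t *: y) - t * f y | t in [set t : R | 0 <= t]].

Let lbS x : lbound (S x) (- f (- x)).
Proof.
move=> _ [t /= t0 <-]; have := sublinearD sf (x + t *: y) (- x).
by rewrite addrAC subrr add0r (sublinearZE _ sf t0); lra.
Qed.

Let S_nonempty x : S x !=set0.
Proof. by exists (f (x + 0 *: y) - 0 * f y), 0 => /=. Qed.

Lemma directional_le t x : 0 <= t -> directional f y x <= f (x + t *: y) - t * f y.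
Proof. by move=> t0; apply: ge_inf; [exists (- f (- x)); exact: lbS|exists t]. Qed.

Let le_directional r x :
  (forall t, 0 <= t -> r <= f (x + t *: y) - t * f y) -> r <= directional f y x.
Proof.
by move=> h; apply: lb_le_inf (S_nonempty x) _ => _ [t /= t0 <-]; exact: h.
Qed.

Lemma directional_le_self x : directional f y x <= f x.
Proof. by have := @directional_le 0 x (lexx _); rewrite scale0r addr0 mul0r subr0. Qed.

Lemma directional_opp : directional f y (- y) <= - f y.
Proof.
have := @directional_le 1 (- y) ler01.
by rewrite scale1r addNr mul1r (sublinear0 sf) add0r.
Qed.

Lemma directional_sublinear : sublinear (directional f y).
Proof.
split.
- apply/eqP; rewrite eq_le; apply/andP; split.
    by rewrite (le_trans (directional_le_self _))// (sublinear0 sf).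
  have := lb_le_inf (S_nonempty 0) (@lbS 0).
  by rewrite oppr0 (sublinear0 sf) oppr0.
(* The two infima on the right are removed one after the other: the parameters [t] for [x] and [s]
   for [x'] are matched by [s + t] for [x + x']. *)
- move=> x x'; rewrite -lerBlDr; apply: le_directional => t t0.
  suff: directional f y (x + x') - (f (x + t *: y) - t * f y) <= directional f y x'.
    lra.
  apply: le_directional => s s0.
  have := @directional_le (s + t) (x + x') (addr_ge0 s0 t0).
  have := sublinearD sf (x + t *: y) (x' + s *: y).
  rewrite addrACA -scalerDl [t + s]addrC; lra.
- move=> a x a0; rewrite -ler_pdivrMl//; apply: le_directional => t t0.
  rewrite ler_pdivrMl//.
  have at0 : 0 <= a * t by rewrite mulr_ge0// ltW.
  apply: le_trans (@directional_le (a * t) _ at0) _.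
  rewrite -scalerA -scalerDr mulrBr mulrA lerD2r.
  exact: sublinearZ.
Qed.

End directional.

(** Zorn's lemma applies because the pointwise infimum of a nonempty chain is finite: every member
    [f] satisfies [f x >= - f (- x) >= - q (- x)]. *)
Lemma minimal_sublinear q : sublinear q -> exists f,
  [/\ sublinear f, forall x, f x <= q x &
      forall g, sublinear g -> (forall x, g x <= f x) -> g = f].
Proof.
move=> sq.
pose T := {f : X -> R | sublinear f /\ forall x, f x <= q x}.
(* The order is reversed, so a maximal element for [ord] is a minimal functional. *)
pose ord (f g : T) := `[< forall x, sval g x <= sval f x >].
have [||||[f [sf fq]] fmin] := @Zorn T ord.
- by move=> f; apply/asboolP.
- move=> f g h /asboolP fg /asboolP gh; apply/asboolP => x.
  exact: le_trans (fg x).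
- move=> [f Pf] [g Pg] /asboolP fg /asboolP gf; apply: eq_exist.
  by apply/funext => x; apply/le_anti/andP; split; [exact: gf|exact: fg].
- move=> A Atot; have [[f0 Af0]|/nonemptyPn A0] := pselect (A !=set0); last first.
    exists (exist _ q (conj sq (fun x => lexx _))) => f.
    by rewrite A0.
  pose V x := [set sval f x | f in A].
  have Vne x : V x !=set0 by exists (sval f0 x), f0.
  have Vlb x : lbound (V x) (- q (- x)).
    move=> _ [f _ <-]; case: (svalP f) => sf fq.
    by apply: le_trans (sublinear_ge x sf); rewrite lerN2.
  pose h x := inf (V x).
  have hle (f : T) x : A f -> h x <= sval f x.
    by move=> Af; apply: ge_inf; [exists (- q (- x)); exact: Vlb|exists f].
  have hge r x : (forall f : T, A f -> r <= sval f x) -> r <= h x.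
    by move=> rA; apply: lb_le_inf => // _ [f Af <-]; exact: rA.
  have hsub : sublinear h.
    split.
    - rewrite /h (_ : V 0 = [set 0]) ?inf1//; apply/seteqP; split => [_ [f Af <-]|_ ->].
        exact: sublinear0 (svalP f).1.
      by exists f0 => //; exact: sublinear0 (svalP f0).1.
    - move=> x y; rewrite -lerBlDr; apply: (hge) => f Af.
      suff: h (x + y) - sval f x <= h y by lra.
      apply: (hge) => g Ag.
      (* In a chain the smaller of [f] and [g] can serve for both arguments. *)
      have [/asboolP/(_ x) fg|/asboolP/(_ y) gf] := Atot f g Af Ag.
        by have := sublinearD (svalP g).1 x y; have := hle g (x + y) Ag; lra.
      by have := sublinearD (svalP f).1 x y; have := hle f (x + y) Af; lra.
    - move=> a x a0; rewrite -ler_pdivrMl//; apply: (hge) => f Af.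
      rewrite ler_pdivrMl//; apply: le_trans (hle f _ Af) _.
      exact: sublinearZ (svalP f).1 _ _ a0.
  have hq x : h x <= q x.
    by apply: le_trans (hle f0 x Af0) _; exact: (svalP f0).2.
  exists (exist _ h (conj hsub hq)) => f Af; apply/asboolP => x /=.
  exact: hle.
- exists f; split => // g sg gf.
  have gq x : g x <= q x by exact: le_trans (gf x) (fq x).
  suff: exist _ g (conj sg gq) = exist _ f (conj sf fq) :> T by move/(congr1 sval).
  by apply: fmin; apply/asboolP.
Qed.

(** Minimality identifies [f] with each [directional f y], so [f] is odd; subadditivity at [- x] and
    [- y] then becomes superadditivity, and oddness carries homogeneity over to negative scalars. *)
Lemma minimal_sublinear_linear f : sublinear f ->
  (forall g, sublinear g -> (forall x, g x <= f x) -> g = f) ->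
  linear_for *%R f.
Proof.
move=> sf fmin.
have fN y : f (- y) = - f y.
  have := directional_opp sf y.
  rewrite (fmin _ (directional_sublinear sf y) (directional_le_self sf y)) => h.
  apply/le_anti; rewrite h/= -{1}[y]opprK; exact: sublinear_ge.
have fD x y : f (x + y) = f x + f y.
  apply/le_anti; rewrite (sublinearD sf)/=.
  have := sublinearD sf (- x) (- y); rewrite -opprD !fN; lra.
move=> a x y; rewrite fD; congr (_ + _).
have [a0|a0] := leP 0 a; first exact: sublinearZE.
rewrite -[a]opprK scaleNr fN (sublinearZE _ sf) ?mulNr//.
by rewrite oppr_ge0 ltW.
Qed.

(** Minimizing below [directional q x] rather than [q] fixes the value at [x]: [l (- x) <= - q x]
    gives [q x <= l x]. *)
Theorem hahn_banach q x : sublinear q ->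
  exists l : {scalar X}, (forall y, l y <= q y) /\ l x = q x.
Proof.
move=> sq.
have [f [sf fq fmin]] := minimal_sublinear (directional_sublinear sq x).
pose l : {scalar X} := HB.pack f
  (GRing.isLinear.Build _ _ _ _ f (minimal_sublinear_linear sf fmin)).
have lq y : l y <= q y by exact: le_trans (fq y) (directional_le_self sq x y).
exists l; split => //; apply/le_anti; rewrite lq/=.
have := le_trans (fq (- x)) (directional_opp sq x).
by rewrite -[f _]/(l _) linearN lerN2.
Qed.

End hahn_banach.

(** * The dual of a Frechet space *)

Section seminorms.
Context (R : realType) (X : tvsType R) (p : nat -> X -> R).
Hypothesis hX : frechet_seminorms p.
Implicit Types (l : {scalar X}) (u v w x y : X).

Let sn k : seminorm (p k) := frechet_seminorm hX k.

Lemma seminormN k x : p k (- x) = p k x.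
Proof. by rewrite -scaleN1r (seminormZ (sn k)) normrN1 mul1r. Qed.

Lemma seminorm_sublinear k : sublinear (p k).
Proof.
split; first by rewrite -(scale0r 0) (seminormZ (sn k)) normr0 mul0r.
  exact: seminormD (sn k).
by move=> a x a0; rewrite (seminormZ (sn k)) gtr0_norm.
Qed.

Lemma seminorm_dominated_continuous l k :
  (forall x, l x <= p k x) -> continuous l.
Proof.
move=> lp x; apply/cvgrPdist_lt => e e0.
apply/(frechet_nbhsE hX); exists k, e => // y /= yx.
apply: le_lt_trans yx; rewrite distrC -linearB ler_norml lp andbT.
by rewrite lerNl -linearN -(seminormN k) lp.
Qed.

(** If every seminorm vanished at [u], then [u] would lie in every neighborhood of 0, against the
    Hausdorff property. *)
Lemma seminorm_gt0 u : u != 0 -> exists k, 0 < p k u.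
Proof.
move=> /eqP u0; apply: contrapT => /forallNP pu; apply: u0; apply/esym.
apply: (frechet_hausdorff hX) => A B nA nB.
have [k [e e0 kA]] := (frechet_nbhsE hX _ _).1 nA.
exists u; split; last exact: nbhs_singleton nB.
by apply: kA => /=; rewrite subr0; apply: le_lt_trans e0; rewrite leNgt; apply/negP.
Qed.

Lemma dual_separates_points u : u != 0 ->
  exists2 l : {scalar X}, continuous l & l u != 0.
Proof.
move=> /seminorm_gt0[k ku]; have [l [lp lu]] := hahn_banach u (seminorm_sublinear k).
by exists l; [exact: seminorm_dominated_continuous lp|rewrite lu gt_eqF].
Qed.

Lemma continuous_scalar_lincomb l1 l2 (a b : R) : continuous l1 -> continuous l2 ->
  exists2 l : {scalar X}, continuous l & forall x, l x = a * l1 x + b * l2 x.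
Proof.
move=> c1 c2; pose f x := a * l1 x + b * l2 x.
have lf : linear_for *%R f by move=> c x y; rewrite /f !linearP/=; ring.
pose l : {scalar X} := HB.pack f (GRing.isLinear.Build _ _ _ _ f lf).
exists l => //= x.
by apply: cvgD; apply: cvgM; [exact: cvg_cst|exact: c1|exact: cvg_cst|exact: c2].
Qed.

(** What the Hahn-Banach theorem gives for a closed subspace [V], isolated as a property that passes
    from the zero subspace to [span2] by adding one line at a time. *)
Definition dual_separated (V : set X) : Prop := forall w, ~ V w ->
  exists l : {scalar X}, [/\ continuous l, forall v, V v -> l v = 0 & l w = 1].

Lemma dual_separated0 : dual_separated [set 0].
Proof.
move=> w /eqP /dual_separates_points[l lc lw].
have [l' l'c l'E] := continuous_scalar_lincomb (l w)^-1 0 lc lc.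
exists l'; split => // [v ->|]; rewrite l'E ?linear0 ?mulr0 ?addr0//.
by rewrite mul0r addr0 mulVf.
Qed.

(** If [u] is outside [V], take [l1] vanishing on [V] with [l1 u = 1], then [l2] vanishing on [V]
    with value 1 at [w - l1 w *: u]. The functional [l2 - l2 u * l1] also kills [u] and equals 1 at
    [w]. *)
Lemma dual_separated_line V u : dual_separated V ->
  dual_separated [set v + a *: u | v in V & a in setT].
Proof.
move=> sV w Vw; have [Vu|/sV[l1 [c1 l1V l1u]]] := pselect (V u).
  have [|l [lc lV lw]] := sV w.
    by move=> Vw'; apply: Vw; exists w => //; exists 0; rewrite ?scale0r ?addr0.
  exists l; split => // _ [v Vv [a _ <-]].
  by rewrite linearD linearZ/= !lV// mulr0 addr0.
have [|l2 [c2 l2V l2w]] := sV (w - l1 w *: u).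
  by move=> Vw'; apply: Vw; exists (w - l1 w *: u) => //; exists (l1 w) => //; rewrite subrK.
have [l lc lE] := continuous_scalar_lincomb 1 (- l2 u) c2 c1.
exists l; split => // [_ [v Vv [a _ <-]]|]; rewrite lE.
  by rewrite !linearD !linearZ/= l1V// l2V// l1u; ring.
by rewrite -[RHS]l2w linearB linearZ/=; ring.
Qed.

Lemma dual_separated_span2 u v : dual_separated (span2 u v).
Proof.
move=> w uvw.
have [|l [lc lV lw]] := @dual_separated_line _ v (dual_separated_line (u := u) dual_separated0) w.
  move=> [_ [_ -> [a _ <-]] [b _ wE]]; apply: uvw; exists a, b.
  by rewrite -wE add0r.
exists l; split => // _ [a [b ->]]; apply: lV.
by exists (0 + a *: u); [exists 0 => //; exists a|exists b => //; rewrite add0r].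
Qed.

Lemma continuous_scalar_bounded l (B : set X) : continuous l ->
  von_neumann_bounded p B -> exists M, forall x, B x -> `|l x| <= M.
Proof.
move=> lc bB; have : nbhs 0 [set x | `|l x| < 1].
  have /cvgrPdist_lt/(_ 1 ltr01) := lc 0.
  by apply: filterS => x /=; rewrite linear0 sub0r normrN.
move=> /(frechet_nbhsE hX)[k [e e0 ke]]; have [c c0 Bc] := bB k.
(* Scaling by [e / (2 * c)] brings [B] to where [p k <= e / 2 < e], hence [|l| < 1]; the bound is
   the inverse of this factor. *)
exists (2 * c / e) => x /Bc xc.
have e2c : 0 < e / (2 * c) by rewrite divr_gt0// mulr_gt0.
have : `|l ((e / (2 * c)) *: x)| < 1.
  apply: ke => /=; rewrite subr0 (seminormZ (sn k)) gtr0_norm//.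
  apply: (@le_lt_trans _ _ (e / (2 * c) * c)); first by rewrite ler_wpM2l// ltW.
  by rewrite (_ : _ * c = e / 2); [lra|field; rewrite gt_eqF].
rewrite linearZ/= normrM gtr0_norm// => h; rewrite ltW//.
have -> : 2 * c / e = (e / (2 * c))^-1 * 1 by field; rewrite !gt_eqF.
by rewrite ltr_pdivlMl.
Qed.

(** [l] is 1 on a limit outside the span of the other two and 0 on those two; [z] is normalized so
    that [psi] is 1 or -1 on it, and the sign of [s] selects the limit. *)
Lemma separating_heaviside (sigma : X -> X) : separating sigma ->
  exists (l : {scalar X}) (z : X), continuous l /\
    forall s : R, l (sigma (n%:R *: (s *: z))) @[n --> \oo] --> ((0 < s)%R%:R : R).
Proof.
move=> [psi [up [um [u0 [psic psi0 usep [lup lum lu0]]]]]].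
have [z0 pz0] : exists z0, psi z0 != 0.
  apply: contrapT => /forallNP psiz; apply: psi0; apply/funext => x.
  by apply/eqP/negPn/negP; exact: psiz.
pose z := (psi z0)^-1 *: z0.
have pz s : psi (s *: z) = s by rewrite !linearZ/= mulVf// mulr1.
have lim l y u : continuous l -> sigma (r *: y) @[r --> +oo] --> u ->
    l (sigma (n%:R *: y)) @[n --> \oo] --> l u.
  move=> lc su.
  apply: (@cvg_comp _ _ _ (fun n => sigma (n%:R *: y)) l _ (nbhs u)); last exact: lc.
  apply: (@cvg_comp _ _ _ (fun n => n%:R) (fun r => sigma (r *: y)) _ _ _ _ su).
  exact: cvgr_idn.
case: usep => /dual_separated_span2[f [fc fV f1]].
  exists f, z; split=> // s.
  have fm : f um = 0 by apply: fV; exists 0, 1; rewrite scale0r scale1r add0r.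
  have f0 : f u0 = 0 by apply: fV; exists 1, 0; rewrite scale0r scale1r addr0.
  have [s0|s0|<-] := ltgtP 0 s.
  - by rewrite (_ : true%:R = f up); [apply: lim => //; apply: lup; rewrite pz|rewrite f1].
  - by rewrite (_ : false%:R = f um); [apply: lim => //; apply: lum; rewrite pz|rewrite fm].
  - by rewrite (_ : false%:R = f u0); [apply: lim => //; apply: lu0; rewrite pz|rewrite f0].
(* Here [um] is the isolated limit, so the direction is reversed: positive [s] must lead to where
   [psi] is negative. *)
exists f, (- z); split=> // s.
have fp : f up = 0 by apply: fV; exists 0, 1; rewrite scale0r scale1r add0r.
have f0 : f u0 = 0 by apply: fV; exists 1, 0; rewrite scale0r scale1r addr0.
rewrite scalerN -scaleNr; have [s0|s0|<-] := ltgtP 0 s.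
- by rewrite (_ : true%:R = f um); [apply: lim => //; apply: lum; rewrite pz oppr_lt0|rewrite f1].
- by rewrite (_ : false%:R = f up); [apply: lim => //; apply: lup; rewrite pz oppr_gt0|rewrite fp].
- by rewrite (_ : false%:R = f u0); [apply: lim => //; apply: lu0; rewrite pz oppr0|rewrite f0].
Qed.

End seminorms.

(** * Measures with the same exponential integrals *)

Section bounded_measurable.
Context d (T : measurableType d) (R : realType) (K : set T).
Hypothesis mK : measurable K.
Implicit Types f g : T -> R.

Definition bounded_mfun f : Prop :=
  measurable_fun K f /\ exists M, forall x, K x -> `|f x| <= M.

Lemma bounded_mfunD f g : bounded_mfun f -> bounded_mfun g ->
  bounded_mfun (fun x => f x + g x).
Proof.
move=> [mf [M fM]] [mg [M' gM]]; split; first exact: measurable_funD.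
exists (M + M') => x Kx; apply: le_trans (ler_normD _ _) _.
by apply: lerD; [exact: fM|exact: gM].
Qed.

Lemma bounded_mfunM f g : bounded_mfun f -> bounded_mfun g ->
  bounded_mfun (fun x => f x * g x).
Proof.
move=> [mf [M fM]] [mg [M' gM]]; split; first exact: measurable_funM.
exists (M * M') => x Kx; rewrite normrM.
by apply: ler_pM => //; [exact: fM|exact: gM].
Qed.

Lemma bounded_mfun_cst (a : R) : bounded_mfun (fun=> a).
Proof. by split; [exact: measurable_cst|exists `|a|]. Qed.

Lemma bounded_mfun_expR f : bounded_mfun f -> bounded_mfun (fun x => expR (f x)).
Proof.
move=> [mf [M fM]]; split; first exact: measurableT_comp.
exists (expR M) => x Kx; rewrite gtr0_norm ?expR_gt0// ler_expR.
by apply: le_trans (fM x Kx); exact: ler_norm.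
Qed.

Lemma bounded_mfun_integrable (m : {finite_measure set T -> \bar R}) f :
  bounded_mfun f -> m.-integrable K (EFin \o f).
Proof.
move=> [mf [M fM]]; apply: measurable_bounded_integrable => //.
  by rewrite ltey_eq fin_num_measure.
exists M; split; rewrite ?num_real// => r Mr x Kx.
exact: le_trans (fM x Kx) (ltW Mr).
Qed.

(** Dominated convergence with a constant majorant, integrable because [m] is finite. *)
Lemma bounded_cvg_Rintegral (m : {finite_measure set T -> \bar R})
    (f_ : nat -> T -> R) f (M : R) :
  (forall n, measurable_fun K (f_ n)) ->
  (forall n x, K x -> `|f_ n x| <= M) ->
  (forall x, K x -> f_ n x @[n --> \oo] --> f x) ->
  \int[m]_(x in K) f_ n x @[n --> \oo] --> \int[m]_(x in K) f x.
Proof.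
move=> mf_ f_M f_f.
have mf : measurable_fun K f by exact: measurable_fun_cvg f_f.
have [||||| + _ cvgf] := @dominated_convergence _ _ _ m K mK
  (fun n => EFin \o f_ n) (EFin \o f) (EFin \o cst M).
- by move=> n; exact/measurable_EFinP.
- exact/measurable_EFinP.
- by apply/aeW => x Kx; apply: cvg_EFin; [exact: nearW|exact: f_f].
- exact/bounded_mfun_integrable/bounded_mfun_cst.
- by apply/aeW => x n Kx; rewrite lee_fin; exact: f_M.
move=> /integrable_fin_num-/(_ mK) ffin; apply: fine_cvg.
by rewrite fineK.
Qed.

Lemma bounded_mfun_cvg (f_ : nat -> T -> R) f (M : R) :
  (forall n, measurable_fun K (f_ n)) ->
  (forall n x, K x -> `|f_ n x| <= M) ->
  (forall x, K x -> f_ n x @[n --> \oo] --> f x) -> bounded_mfun f.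
Proof.
move=> mf_ f_M f_f; split; first exact: measurable_fun_cvg f_f.
exists M => x Kx.
have fx : `|f_ n x| @[n --> \oo] --> `|f x| by apply: cvg_norm; exact: f_f.
rewrite -(cvg_lim (@Rhausdorff R) fx); apply: limr_le; first exact: cvgP fx.
by apply: nearW => n; exact: f_M.
Qed.

End bounded_measurable.

(** * Functions balanced against exponentials, and the sigma-algebra of half-spaces *)

Section exponential_determining.
Context d (T : measurableType d) (R : realType).
Context (mu nu : {finite_measure set T -> \bar R}) (K : set T).
Hypothesis mK : measurable K.
Context (Phi : set (T -> R)).
Hypothesis Phi_bounded : forall phi, Phi phi -> bounded_mfun K phi.
Hypothesis PhiD : forall phi psi, Phi phi -> Phi psi ->
  Phi (fun x => phi x + psi x).
Hypothesis PhiZ : forall (a : R) phi, Phi phi -> Phi (fun x => a * phi x).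
Implicit Types f g phi : T -> R.

(** When [mu] and [nu] are the Jordan parts of a charge, this says that the integral of [f] against
    the charge is zero. *)
Definition same_integral f : Prop :=
  \int[mu]_(x in K) f x = \int[nu]_(x in K) f x.

Hypothesis Phi_exp : forall phi, Phi phi -> same_integral (fun x => expR (phi x)).

Lemma eq_same_integral f g : {in K, f =1 g} -> same_integral f -> same_integral g.
Proof. by move=> fg; rewrite /same_integral !(eq_Rintegral _ fg). Qed.

Lemma same_integral_lincomb (a : R) f g : bounded_mfun K f -> bounded_mfun K g ->
  same_integral f -> same_integral g -> same_integral (fun x => f x + a * g x).
Proof.
move=> bf bg; rewrite /same_integral => fE gE.
have bag : bounded_mfun K (fun x => a * g x).
  by apply: bounded_mfunM => //; exact: bounded_mfun_cst.
rewrite !RintegralD ?RintegralZl ?fE ?gE//; exact: bounded_mfun_integrable.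
Qed.

Lemma same_integral_cvg (f_ : nat -> T -> R) f (M : R) :
  (forall n, measurable_fun K (f_ n)) ->
  (forall n x, K x -> `|f_ n x| <= M) ->
  (forall x, K x -> f_ n x @[n --> \oo] --> f x) ->
  (forall n, same_integral (f_ n)) -> same_integral f.
Proof.
move=> mf_ f_M f_f fE; have cmu := bounded_cvg_Rintegral mK (m := mu) mf_ f_M f_f.
have cnu := bounded_cvg_Rintegral mK (m := nu) mf_ f_M f_f.
move: cmu; under eq_fun do rewrite fE.
by move=> cmu; exact: cvg_unique cmu cnu.
Qed.

(* The condition is stable under multiplication by exponentials, unlike
   [same_integral] itself. *)
Definition balanced f : Prop := bounded_mfun K f /\
  forall phi, Phi phi -> same_integral (fun x => f x * expR (phi x)).

Let bexp phi : Phi phi -> bounded_mfun K (fun x => expR (phi x)).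
Proof. by move=> /Phi_bounded; exact: bounded_mfun_expR. Qed.

Lemma eq_balanced f g : {in K, f =1 g} -> balanced f -> balanced g.
Proof.
move=> fg [[mf [M fM]] fE]; split.
  split; first exact: eq_measurable_fun mf.
  by exists M => x Kx; rewrite -fg ?inE//; exact: fM.
move=> phi Pphi; apply: eq_same_integral (fE _ Pphi) => x Kx.
by rewrite fg.
Qed.

Lemma balanced1 : balanced (fun=> 1).
Proof.
split; first exact: bounded_mfun_cst.
move=> phi /Phi_exp; apply: eq_same_integral => x _; by rewrite mul1r.
Qed.

Lemma balanced_lincomb (a : R) f g : balanced f -> balanced g ->
  balanced (fun x => f x + a * g x).
Proof.
move=> [bf fE] [bg gE]; split.
  apply: bounded_mfunD => //; apply: bounded_mfunM => //; exact: bounded_mfun_cst.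
move=> phi Pphi; pose h x := f x * expR (phi x) + a * (g x * expR (phi x)).
apply: (@eq_same_integral h); first by move=> x _; rewrite /h; ring.
apply: same_integral_lincomb; [| |exact: fE|exact: gE].
- by apply: bounded_mfunM => //; exact: bexp.
- by apply: bounded_mfunM => //; exact: bexp.
Qed.

(** The new factor merges with the test exponential, [Phi] being stable under sums. *)
Lemma balanced_expR f phi : balanced f -> Phi phi ->
  balanced (fun x => f x * expR (phi x)).
Proof.
move=> [bf fE] Pphi; split; first by apply: bounded_mfunM => //; exact: bexp.
move=> psi Ppsi; apply: eq_same_integral (fE _ (PhiD Pphi Ppsi)) => x _.
by rewrite expRD mulrA.
Qed.

Lemma balanced_cvg (f_ : nat -> T -> R) f (M : R) :
  (forall n, balanced (f_ n)) ->
  (forall n x, K x -> `|f_ n x| <= M) ->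
  (forall x, K x -> f_ n x @[n --> \oo] --> f x) -> balanced f.
Proof.
move=> bf_ f_M f_f; have mf_ n : measurable_fun K (f_ n) by have [[]] := bf_ n.
split; first exact: bounded_mfun_cvg mf_ f_M f_f.
move=> phi Pphi; have [mphi [N phiN]] := bexp Pphi.
apply: (@same_integral_cvg (fun n x => f_ n x * expR (phi x)) _ (M * N)).
- by move=> n; exact: measurable_funM.
- by move=> n x Kx; rewrite normrM ler_pM// ?phiN// f_M.
- by move=> x Kx; apply: cvgM; [exact: f_f|exact: cvg_cst].
- by move=> n; have [_] := bf_ n; exact.
Qed.

(** The partial sums of the exponential series at [- expR (phi x + c)] are linear combinations of
    the [expR (n%:R * phi x)], uniformly bounded on [K]. The constant [c] is kept apart because
    constants need not belong to [Phi]; it only affects the coefficients. *)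
Lemma balanced_expR_expR f phi (c : R) : balanced f -> Phi phi ->
  balanced (fun x => f x * expR (- expR (phi x + c))).
Proof.
move=> bf Pphi; have [[_ [M fM]] _] := bf.
have [_ [N phiN]] := bounded_mfunM (bexp Pphi) (bounded_mfun_cst K (expR c)).
pose S n x : R := series (exp_coeff (- expR (phi x + c))) n.
apply: (@balanced_cvg (fun n x => f x * S n x) _ (M * expR N)).
- elim=> [|n IH].
    apply: (@eq_balanced (fun x => f x + -1 * f x)); last exact: balanced_lincomb.
    by move=> x _; rewrite /S/series/= big_geq// mulr0 mulN1r subrr.
  (* The coefficient of [expR (n%:R * phi x)] in the term of index [n] of the series. *)
  pose a : R := (-1) ^+ n * expR (n%:R * c) / n`!%:R.
  apply: (@eq_balanced (fun x => f x * S n x + a * (f x * expR (n%:R * phi x)))).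
    move=> x _; rewrite /S/series/= big_nat_recr//= mulrDr; congr (_ + _).
    rewrite /exp_coeff/= exprNn -expRM_natl mulrDr expRD /a; ring.
  by apply: balanced_lincomb => //; apply: balanced_expR => //; exact: PhiZ.
- move=> n x Kx; rewrite normrM ler_pM// ?fM//.
  (* The absolute values of the terms add up to at most the full series at [expR (phi x + c)], a
     number bounded by [N]. *)
  apply: (@le_trans _ _ (expR `|- expR (phi x + c)|)); last first.
    rewrite ler_expR normrN expRD; exact: phiN.
  apply: le_trans (ler_norm_sum _ _ _) _.
  rewrite -[leLHS]/([normed series (exp_coeff _)] n) normed_series_exp_coeff.
  apply: nondecreasing_cvgn_le; last exact: is_cvg_series_exp_coeff.
  apply/nondecreasing_seqP => k; rewrite /series/= big_nat_recr//= lerDl.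
  exact: exp_coeff_ge0.
- move=> x Kx; apply: cvgM; first exact: cvg_cst.
  exact: is_cvg_series_exp_coeff.
Qed.

Lemma balanced_halfspace f phi (t : R) : balanced f -> Phi phi ->
  balanced (fun x => f x * \1_[set x | phi x <= t] x).
Proof.
move=> bf Pphi; have [[_ [M fM]] _] := bf.
(* c n x = n^2 (phi x - t) - n, where the term - n yields the limit 1 also when
   phi x = t. *)
pose c n x : R := (n%:R ^+ 2 * phi x) + (- (n%:R ^+ 2 * t) - n%:R).
apply: (@balanced_cvg (fun n x => f x * expR (- expR (c n x))) _ M).
- by move=> n; apply: balanced_expR_expR => //; exact: PhiZ.
- move=> n x Kx; rewrite normrM; apply: le_trans (fM x Kx).
  by rewrite ler_piMr// gtr0_norm ?expR_gt0// expR_le1 oppr_le0 expR_ge0.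
move=> x Kx; apply: cvgM; first exact: cvg_cst.
(* [harmonic n] is [1 / (n + 1)], and the bound is the inverse of [1 + n <= expR n]. It gives the
   rate of convergence on both sides of [t]. *)
have small n : expR (- n%:R) <= harmonic n :> R.
  by rewrite expRN lef_pV2 ?posrE ?expR_gt0 ?ltr0n// -natr1 addrC expR_ge1Dx.
rewrite indicE; have [xt|tx] := leP (phi x) t.
  rewrite mem_set//=.
  apply: (@squeeze_cvgr _ _ _ _ (fun n => 1 - harmonic n) (cst 1)); last 2 first.
  - rewrite -[X in _ --> X](subr0 (1 : R)); apply: cvgB; first exact: cvg_cst.
    exact: cvg_harmonic.
  - exact: cvg_cst.
  apply: nearW => n; apply/andP; split; last first.
    by rewrite expR_le1 oppr_le0 expR_ge0.
  apply: le_trans (expR_ge1Dx _); rewrite lerD2l lerN2.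
  apply: le_trans (small n); rewrite ler_expR /c.
  have : n%:R ^+ 2 * (phi x - t) <= 0 by rewrite mulr_ge0_le0 ?subr_le0// exprn_ge0.
  by rewrite mulrBr; lra.
rewrite memNset ?mulr0n/=; last by apply/negP; rewrite -ltNge.
apply: (@squeeze_cvgr _ _ _ _ (cst 0) harmonic); last 2 first.
- exact: cvg_cst.
- exact: cvg_harmonic.
near=> n; rewrite expR_ge0/=; apply: le_trans (small n); rewrite ler_expR lerN2.
apply: le_trans (expR_ge1Dx _); apply: (@le_trans _ _ (c n x)); last by rewrite lerDr.
(* Then [n^2 (phi x - t) >= 2 n], so that [c n x >= n]. *)
have : 2 <= n%:R * (phi x - t).
  rewrite -ler_pdivrMr ?subr_gt0//; near: n; exact: nbhs_infty_ger.
move=> /(ler_wpM2l (ler0n R n)); rewrite /c; nra.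
Unshelve. all: by end_near. Qed.

Definition halfspaces : set (set T) :=
  [set [set x | phi x <= t] | phi in Phi & t in [set: R]].

Hypothesis Phi_measurable : forall phi, Phi phi -> measurable_fun [set: T] phi.

Let indicM (A B : set T) x : \1_(A `&` B) x = \1_A x * \1_B x :> R.
Proof. by rewrite !indicE in_setI -natrM mulnb. Qed.

Let indicC (A : set T) x : \1_(~` A) x = 1 - \1_A x :> R.
Proof. by rewrite !indicE in_setC; case: (_ \in _); rewrite ?subrr ?subr0. Qed.

Lemma measurable_halfspace phi (t : R) :
  Phi phi -> measurable [set x | phi x <= t].
Proof.
move=> Pphi; rewrite -[X in measurable X]setTI.
rewrite (_ : [set x | phi x <= t] = phi @^-1` `]-oo, t]%classic).
  by apply: Phi_measurable => //; exact: measurable_itv.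
by apply/seteqP; split => x /=; rewrite in_itv.
Qed.

Lemma halfspace_sigma_measurable (A : set T) :
  <<s halfspaces >> A -> measurable A.
Proof.
apply: smallest_sub; last by move=> _ [phi Pphi [t _ <-]]; exact: measurable_halfspace.
split=> [|B mB|F mF]; [exact: measurable0|exact: measurableD|].
exact: bigcup_measurable.
Qed.

Lemma balanced_halfspace_sigma f (A : set T) :
  <<s halfspaces >> A -> balanced f -> balanced (fun x => f x * \1_A x).
Proof.
move=> hA.
(* Quantifying over all [f] lets multiplications by indicators be iterated, so the class is stable
   under finite intersections; complements and bounded limits then make it a sigma-algebra. *)
suff: <<s halfspaces >> `<=` [set A : set T | measurable A /\
    forall f, balanced f -> balanced (fun x => f x * \1_A x)].
  by move=> /(_ A hA)[_]; exact.
move=> {f A hA}; apply: smallest_sub; last first.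
  move=> _ [phi Pphi [t _ <-]]; split; last by move=> f bf; exact: balanced_halfspace.
  exact: measurable_halfspace.
have compl A : measurable A /\ (forall f, balanced f ->
    balanced (fun x => f x * \1_A x)) ->
    measurable (~` A) /\ forall f, balanced f ->
    balanced (fun x => f x * \1_(~` A) x).
  move=> [mA bA]; split=> [|f bf]; first exact: measurableC.
  apply: (@eq_balanced (fun x => f x + -1 * (f x * \1_A x))).
    by move=> x _; rewrite indicC; ring.
  by apply: balanced_lincomb => //; exact: bA.
split => [|A hA|F hF].
- split=> // f bf; apply: (@eq_balanced (fun x => f x + -1 * f x)).
    by move=> x _; rewrite indic0/= mulr0 mulN1r subrr.
  exact: balanced_lincomb.
- by rewrite setTD; exact: compl.
have mF n : measurable (F n) by have [] := hF n.
rewrite -[X in [set _ | _] X]setCK; apply: (compl); rewrite setC_bigcup.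
split; first by apply: bigcapT_measurable => n; exact: measurableC.
move=> f bf; pose G n := \big[setI/setT]_(k < n) ~` F k.
have [[_ [M fM]] _] := bf.
apply: (@balanced_cvg (fun n x => f x * \1_(G n) x) _ M).
- elim=> [|n IH].
    apply: (@eq_balanced f) => // x _.
    by rewrite /G big_ord0 indicT mulr1.
  apply: (@eq_balanced (fun x => (f x * \1_(G n) x) * \1_(~` F n) x)).
    by move=> x _; rewrite /G big_ord_recr/= indicM mulrA.
  by have [_] := compl _ (hF n); apply.
- move=> n x Kx; rewrite normrM; apply: le_trans (fM x Kx).
  by rewrite ler_piMr// indicE; case: (_ \in _); rewrite ?normr1 ?normr0.
- move=> x Kx; apply: cvgM; first exact: cvg_cst.
  have GE n : G n = \bigcap_(k in `I_n) ~` F k by rewrite /G bigcap_mkord.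
  have [Fx|Fx] := pselect ((\bigcap_n ~` F n) x).
    rewrite indicE mem_set//; apply: cvg_near_cst; apply: nearW => n.
    by rewrite indicE mem_set// GE => k _; exact: Fx.
  have [k Fkx] : exists k, F k x.
    by apply: contrapT => /forallNP h; apply: Fx => k _; exact: h.
  rewrite [X in _ --> X]indicE memNset//; apply: cvg_near_cst; near=> n.
  rewrite indicE memNset// GE => /(_ k); apply => //=.
  by near: n; exact: nbhs_infty_gt.
Unshelve. all: by end_near. Qed.

Theorem exponential_determining_halfspaces (A : set T) :
  <<s halfspaces >> A -> Phi !=set0 -> mu (A `&` K) = nu (A `&` K).
Proof.
move=> hA [phi Pphi]; have mA := halfspace_sigma_measurable hA.
have [_ bA] := balanced_halfspace_sigma hA balanced1.
(* The exponential of [0 * phi] is the constant 1, so the test function disappears. *)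
have AE := bA _ (PhiZ 0 Pphi).
have: same_integral (\1_A).
  by apply: eq_same_integral AE => x _; rewrite mul0r expR0 mulr1 mul1r.
have fin (m : {finite_measure set T -> \bar R}) : m (A `&` K) \is a fin_num.
  by rewrite fin_num_measure//; exact: measurableI.
rewrite /same_integral /Rintegral !integral_indic// => AKE.
by rewrite -[LHS]fineK ?fin// AKE fineK ?fin.
Qed.

End exponential_determining.

(** * Regular Borel measures *)

(** The near-covering form of compactness is applied along the filter [F] generated by the families
    of all supersets of a member of [S]; stability under unions makes [F] a filter. *)
Lemma compact_cover_ind (T : topologicalType) (L : set T) (S : set (set T)) :
  compact L -> S set0 -> (forall A B, S A -> S B -> S (A `|` B)) ->
  (forall y, L y -> exists2 B, S B & nbhs y B) -> exists2 B, S B & L `<=` B.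
Proof.
move=> /compact_near_coveringP cL S0 SU SL.
pose F : set_system (set T) := filter_from S (fun B => [set B' | B `<=` B']).
have FF : Filter F.
  apply: filter_from_filter; first by exists set0.
  move=> A B SA SB; exists (A `|` B); first exact: SU.
  by move=> D; rewrite /= subUset.
have [|B SB LB] := cL _ F (fun B y => B y) FF.
  move=> y /SL[B SB yB]; exists (B, [set B' | B `<=` B']).
    by split => //; exists B.
  by move=> [y' B'] [/= By' BB']; exact: BB'.
by exists B => //; exact: LB.
Qed.

(** As for compact sets in a Hausdorff space: finite intersections separate a point of [C] from [L],
    then finite unions separate [C] from [L]. *)
Lemma compact_separation (T : topologicalType) (G : set (set T)) (C L : set T) :
  compact C -> compact L -> G set0 -> G setT ->
  (forall A B, G A -> G B -> G (A `|` B)) ->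
  (forall A B, G A -> G B -> G (A `&` B)) ->
  (forall x y, C x -> L y -> exists A, [/\ G A, nbhs x A & nbhs y (~` A)]) ->
  exists A, [/\ G A, C `<=` A & A `&` L = set0].
Proof.
move=> cC cL G0 GT GU GI sep.
have [|||A [GA AL0] CA] := @compact_cover_ind T C (G `&` [set A | A `&` L = set0]) cC.
- by split=> //=; rewrite set0I.
- move=> A B [GA /= A0] [GB /= B0]; split; first exact: GU.
  by rewrite /= setIUl A0 B0 setU0.
- move=> x Cx.
  have [|||B [A [GA xA AB]] LB] := @compact_cover_ind T L
    [set B | exists A, [/\ G A, nbhs x A & A `&` B = set0]] cL.
  + by exists setT; split=> //; [exact: filterT|rewrite setI0].
  + move=> B1 B2 [A1 [G1 x1 AB1]] [A2 [G2 x2 AB2]]; exists (A1 `&` A2).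
    split; [exact: GI|exact: filterI|].
    by rewrite setIUr setIAC AB1 set0I -setIA AB2 setI0 setU0.
  + move=> y Ly; have [A [GA xA yA]] := sep x y Cx Ly.
    by exists (~` A) => //; exists A; rewrite setICr.
  exists A => //; split=> //=; apply/seteqP; split => // z [Az Lz].
  by rewrite -AB; split=> //; exact: LB.
- by exists A.
Qed.

(** * Exponential integrals determined by the masses of rays *)

Section rays.
Context d (T : measurableType d) (R : realType).
Context (K : set T) (mK : measurable K) (phi : T -> R).
Hypothesis mphi : measurable_fun [set: T] phi.

Let integral_restr (m : {measure set T -> \bar R}) :
  (\int[m]_(x in K) (expR (phi x))%:E =
   \int[pushforward (mrestr m mK) phi]_y (expR y)%:E)%E.
Proof.
rewrite [RHS]ge0_integral_pushforward//; last first.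
  exact/(@measurable_EFinP _ _ _ _ expR).
rewrite (@eq_measure_integral _ _ _ K (mrestr m mK)); last first.
  by move=> A mA AK; rewrite /= /mrestr setIidl.
rewrite preimage_setT [RHS](@ge0_negligible_integral _ _ _ _ [set: T] (~` K))//.
- by rewrite setTD setCK.
- exact: measurableC.
- by apply/(@measurable_EFinP _ _ _ _ (expR \o phi)); exact: measurableT_comp.
- by move=> x _; rewrite lee_fin expR_ge0.
- by rewrite /= /mrestr setICl measure0.
Qed.

(** The images under [phi] of the two measures restricted to [K] agree on the rays, a generating
    class stable under intersection, so they are equal; both integrals are integrals of [expR]
    against these images. *)
Lemma eq_on_rays_integral_expR (mu nu : {finite_measure set T -> \bar R}) :
  (forall t : R, mu (K `&` [set x | t < phi x]) = nu (K `&` [set x | t < phi x])) ->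
  same_integral mu nu K (fun x => expR (phi x)).
Proof.
move=> munu; rewrite /same_integral /Rintegral !integral_restr; congr fine.
apply: eq_measure_integral => A mA _.
pose G := @RGenOInfty.G R.
(* Rays of finite mass exhausting the line, as uniqueness of measures requires. *)
pose g (n : nat) : set R := `]- n%:R, +oo[%classic.
have Ggen : @measurable _ (R : measurableType _) = <<s G >>.
  exact: RGenOInfty.measurableE.
apply: (@measure_unique _ _ _ G g) => //.
- move=> _ _ [x ->] [y ->]; exists (Num.max x y).
  apply/seteqP; split => z /=; rewrite !in_itv/= !andbT gt_max.
    by move=> [-> ->].
  by move=> /andP[].
- by move=> n; exists (- n%:R).
- rewrite -subTset => x _; exists (Num.truncn `|x|).+1 => //=.
  rewrite /g/= in_itv/= andbT ltrNl; apply: le_lt_trans (truncnS_gt _).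
  by rewrite -normrN ler_norm.
- move=> _ [t ->].
  rewrite -[LHS]/(mu (phi @^-1` `]t, +oo[ `&` K)) -[RHS]/(nu (phi @^-1` `]t, +oo[ `&` K)).
  rewrite (_ : phi @^-1` `]t, +oo[ = [set x | t < phi x]).
    by rewrite setIC munu.
  by apply/seteqP; split => x /=; rewrite in_itv/= andbT.
- move=> n; rewrite -[X in (X < _)%E]/(mu (phi @^-1` (g n) `&` K)).
  rewrite ltey_eq fin_num_measure//; apply: measurableI => //.
  rewrite -[X in measurable X]setTI.
  by apply: mphi => //; exact: measurable_itv.
Qed.

End rays.

Section borel.
Context (R : realType) (X : tvsType R).

Lemma open_borel_measurable (U : set X) : open U -> measurable (U : set (borel X)).
Proof. by move=> oU; exact: sub_sigma_algebra. Qed.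

Lemma closed_borel_measurable (F : set X) :
  closed F -> measurable (F : set (borel X)).
Proof.
by move=> cF; rewrite -[F]setCK; apply: measurableC; apply: open_borel_measurable;
  exact: closed_openC.
Qed.

Lemma compact_borel_measurable (C : set X) :
  hausdorff_space X -> compact C -> measurable (C : set (borel X)).
Proof. by move=> hX cC; apply: closed_borel_measurable; exact: compact_closed. Qed.

Lemma continuous_borel_measurable (f : X -> R) : continuous f ->
  measurable_fun [set: borel X] (f : borel X -> R).
Proof.
move=> cf mD; apply: (measurability _ (RGenOInfty.measurableE R)) => //.
move=> _ [_ [t ->] <-]; rewrite setTI; apply: open_borel_measurable.
by apply: open_comp => //; exact: interval_open.
Qed.

End borel.

(** * Comparison of measures on a class separating compact sets *)

Section regular.
Context (R : realType) (X : tvsType R) (K : set X).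
Hypotheses (hausX : hausdorff_space X) (cK : compact K).
Context (G : set (set (borel X))).
Hypothesis G_measurable : forall A, G A -> measurable A.
Hypothesis G_separates : forall C L : set X, compact C -> compact L ->
  C `&` L = set0 -> exists A, [/\ G A, C `<=` A & A `&` L = set0].

Let mK : measurable (K : set (borel X)).
Proof. exact: compact_borel_measurable. Qed.

(** With [C] compact inside [E], [U] open around it and [A] in [G] between [C] and [U] within [K],
    [mu E] is within [e / 2] of [mu C <= mu (A & K) = nu (A & K) <= nu (U & K)], which exceeds
    [nu E] by at most [e / 2]. Approximation for the sum [m] controls both measures. *)
Lemma regular_le (mu nu : {finite_measure set (borel X) -> \bar R})
    (m : {measure set (borel X) -> \bar R}) (E : set (borel X)) :
  (forall A, m A = mu A + nu A)%E -> regular_measure_on K m ->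
  (forall A, G A -> mu (A `&` K) = nu (A `&` K)) ->
  measurable E -> E `<=` K -> (mu E <= nu E)%E.
Proof.
move=> mE mreg Gmunu mE' EK.
have fin (n : {finite_measure set (borel X) -> \bar R}) A :
  measurable A -> n A \is a fin_num by move=> mA; exact: fin_num_measure.
have mfin A : measurable A -> m A \is a fin_num.
  by move=> mA; rewrite mE fin_numD; apply/andP; split; exact: fin.
apply/lee_addgt0Pr => e e0; have e20 : 0 < e / 2 by rewrite divr_gt0.
have [_ [C [cC CE] <-] Cm] : exists2 y, [set m F | F in [set F : set X |
    compact F /\ F `<=` E]] y & (m E - (e / 2)%:E < y)%E.
  apply: ereal_sup_gt; rewrite -(regular_inner mreg mE' EK).
  by rewrite lteBlDr// lteDl ?mfin// lte_fin.
have [_ [U [oU EU] <-] Um] : exists2 y, [set m (U `&` K) | U in [set U : set X |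
    open U /\ E `<=` U]] y & (y < m E + (e / 2)%:E)%E.
  apply: ereal_inf_lt; rewrite -(regular_outer mreg mE' EK).
  by rewrite lteDl ?mfin// lte_fin.
have mC : measurable (C : set (borel X)).
  exact: compact_borel_measurable.
have mUK : measurable (U `&` K : set (borel X)).
  by apply: measurableI => //; exact: open_borel_measurable.
(* The part of [K] outside [U] is compact, and it misses [C] because [U] contains [E]. *)
have [A [GA CA AL]] : exists A, [/\ G A, C `<=` A & A `&` (K `&` ~` U) = set0].
  apply: G_separates => //.
    by apply: compact_closedI => //; exact: open_closedC.
  by apply/seteqP; split => // x [/CE/EU Ux [_]].
have mAK : measurable (A `&` K) by apply: measurableI => //; exact: G_measurable.
have AKU : A `&` K `<=` U `&` K.
  move=> x [Ax Kx]; split => //; apply: contrapT => Ux.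
  by suff: (A `&` (K `&` ~` U)) x by rewrite AL.
have CAK : C `<=` A `&` K by move=> x Cx; split; [exact: CA|exact/EK/CE].
have mono (n : {finite_measure set (borel X) -> \bar R}) (B D : set (borel X)) :
    measurable B -> measurable D -> B `<=` D -> (n B <= n D)%E.
  by move=> mB mD BD; apply: le_measure => //; rewrite inE.
have EUK : E `<=` U `&` K by move=> x Ex; split; [exact: EU|exact: EK].
move: (mono mu _ _ mE' mUK EUK) (mono mu _ _ mC mAK CAK) (mono nu _ _ mAK mUK AKU)
  (mono nu _ _ mC mE' CE) (mono nu _ _ mC mUK (subset_trans CE EUK)) Cm Um.
rewrite !mE -(Gmunu _ GA).
rewrite -(fineK (fin mu _ mE')) -(fineK (fin nu _ mE')) -(fineK (fin mu _ mUK))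
  -(fineK (fin nu _ mUK)) -(fineK (fin mu _ mC)) -(fineK (fin nu _ mC))
  -(fineK (fin mu _ mAK)).
rewrite -!EFinD !lee_fin !lte_fin.
lra.
Qed.

Lemma regular_eq (mu nu : {finite_measure set (borel X) -> \bar R})
    (m : {measure set (borel X) -> \bar R}) (E : set (borel X)) :
  (forall A, m A = mu A + nu A)%E -> regular_measure_on K m ->
  (forall A, G A -> mu (A `&` K) = nu (A `&` K)) ->
  measurable E -> E `<=` K -> mu E = nu E.
Proof.
move=> mE mreg Gmunu mE' EK; apply/eqP; rewrite eq_le.
rewrite (regular_le mE mreg Gmunu)//=.
apply: (regular_le _ mreg _ mE' EK) => A; first by rewrite mE addeC.
by move=> /Gmunu.
Qed.

End regular.

(** * Half-spaces defined by continuous functionals *)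

Section functional_halfspaces.
Context (R : realType) (X : tvsType R) (p : nat -> X -> R).
Hypothesis hX : frechet_seminorms p.

(** The dual as plain functions on a measurable space, the form expected of [Phi]. *)
Definition dual_functions : set (borel X -> R) :=
  [set (l : X -> R) | l in [set l : {scalar X} | continuous l]].

Lemma dual_functionsD f g : dual_functions f -> dual_functions g ->
  dual_functions (fun x => f x + g x).
Proof.
move=> [l lc <-] [l' l'c <-].
have [h hc hE] := continuous_scalar_lincomb 1 1 lc l'c.
by exists h => //; apply/funext => x; rewrite hE !mul1r.
Qed.

Lemma dual_functionsZ (a : R) f : dual_functions f ->
  dual_functions (fun x => a * f x).
Proof.
move=> [l lc <-]; have [h hc hE] := continuous_scalar_lincomb a 0 lc lc.
by exists h => //; apply/funext => x; rewrite hE mul0r addr0.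
Qed.

Lemma dual_functions_measurable f :
  dual_functions f -> measurable_fun [set: borel X] f.
Proof. by move=> [l lc <-]; exact: continuous_borel_measurable. Qed.

Lemma dual_functions_bounded (K : set X) f : compact K ->
  measurable (K : set (borel X)) -> dual_functions f ->
  bounded_mfun (K : set (borel X)) f.
Proof.
move=> cK mK df; split.
  by apply: measurable_funTS; exact: dual_functions_measurable.
move: df => [l lc <-].
have /compact_bounded[M [_ Mb]] : compact (l @` K).
  by apply: continuous_compact => //; exact: continuous_subspaceT.
exists (M + 1) => x Kx; apply: Mb; first by rewrite ltrDl.
by exists x.
Qed.

Lemma dual_halfspaces_separate (C L : set X) : compact C -> compact L ->
  C `&` L = set0 ->
  exists A, [/\ <<s halfspaces dual_functions >> A, C `<=` A & A `&` L = set0].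
Proof.
move=> cC cL CL.
pose T := g_sigma_algebraType (halfspaces dual_functions).
apply: (@compact_separation X (@measurable _ T) C L cC cL).
- exact: (@measurable0 _ T).
- exact: (@measurableT _ T).
- exact: (@measurableU _ T).
- exact: (@measurableI _ T).
move=> x y Cx Ly; have yx : y - x != 0.
  apply/negP => /eqP/subr0_eq yx.
  have : (C `&` L) x by split=> //; rewrite -yx.
  by rewrite CL.
have [l lc lyx] := dual_separates_points hX yx.
(* Multiplying [l] by [l (y - x)] fixes the sign: the value at [y - x] becomes a nonzero square. *)
have [f fc fyx] : exists2 f : {scalar X}, continuous f & f x < f y.
  have [f fc fE] := continuous_scalar_lincomb (l (y - x)) 0 lc lc.
  exists f => //; rewrite -subr_gt0 -linearB fE mul0r addr0.
  by rewrite -expr2 exprn_even_gt0.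
(* The midpoint leaves [x] in the interior of the half-space and [y] in that of its complement. *)
pose t := (f x + f y) / 2.
exists [set z | f z <= t]; split.
- by apply: sub_sigma_algebra; exists (f : X -> R); [exists f|exists t].
- have : \forall z \near x, f z < t by apply: (cvgr_lt (f x)); [exact: fc|rewrite /t; lra].
  by apply: filterS => z /= /ltW.
- have : \forall z \near y, t < f z by apply: (cvgr_gt (f y)); [exact: fc|rewrite /t; lra].
  by apply: filterS => z /= tz; apply/negP; rewrite -ltNge.
Qed.

End functional_halfspaces.

(** * Equality on half-spaces from the annihilation hypothesis *)

Section annihilation.
Context (R : realType) (X : tvsType R) (p : nat -> X -> R).
Hypothesis hX : frechet_seminorms p.

Lemma continuous_scale_cst (T : topologicalType) (g : T -> R) (z : X) :
  continuous g -> continuous (fun x => g x *: z).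
Proof.
move=> gc x.
apply: (@cvg_comp _ _ _ (fun y => (g y : R^o, z)) (fun u => u.1 *: u.2) _
  (nbhs (g x : R^o, z))); last exact: (@scale_continuous _ _ (g x : R^o, z)).
by apply: (cvg_pair (G := nbhs (g x : R^o)) (H := nbhs z)); [exact: gc|exact: cvg_cst].
Qed.

(** These are the operators at which the annihilation hypothesis is evaluated. *)
Lemma continuous_rank1 (l : {scalar X}) (z : X) : continuous l ->
  exists2 A : {linear X -> X}, continuous A & forall x, A x = l x *: z.
Proof.
move=> lc; pose f x := l x *: z.
have lf : linear f by move=> c x y; rewrite /f linearP/= scalerDl scalerA.
pose A : {linear X -> X} := HB.pack f (GRing.isLinear.Build _ _ _ _ f lf).
by exists A => //; exact: continuous_scale_cst.
Qed.

Variables (sigma : X -> X).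
Hypothesis sigma_cont : continuous sigma.
Hypothesis sigma_bounded : von_neumann_bounded p (range sigma).
Hypothesis sigma_sep : separating sigma.
Variables (K : set X) (mK : measurable (K : set (borel X))).
Variables (mu nu : {finite_measure set (borel X) -> \bar R}).
Hypothesis munu : forall (ell : {scalar X}) (A : {linear X -> X}) (b : X),
  continuous ell -> continuous A ->
  same_integral mu nu K (fun x => ell (sigma (A x + b))).

(** The functions [f n] tend pointwise to the indicator of [t < phi x] by [separating_heaviside],
    with a uniform bound since [sigma] has bounded range. *)
Lemma annihilated_rays (phi : {scalar X}) (t : R) : continuous phi ->
  mu (K `&` [set x | t < phi x]) = nu (K `&` [set x | t < phi x]).
Proof.
move=> phic; have [l [z [lc lim]]] := separating_heaviside hX sigma_sep.
have [M lM] := continuous_scalar_bounded hX lc sigma_bounded.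
pose f n x := l (sigma (n%:R *: ((phi x - t) *: z))).
pose B : set (borel X) := [set x | t < phi x].
have mB : measurable B.
  apply: open_borel_measurable.
  by apply: (@open_comp _ _ phi [set r | t < r]) => //; exact: open_gt.
have sB : same_integral mu nu K (\1_B).
  apply: (@same_integral_cvg _ _ _ mu nu K mK f _ M).
  - move=> n; apply: measurable_funTS; apply: continuous_borel_measurable.
    rewrite (_ : f n = (l : X -> R) \o sigma \o (fun x => (n%:R * (phi x - t)) *: z)).
      move=> x; apply: continuous_comp.
        2: by apply: continuous_comp; [exact: sigma_cont|exact: lc].
      apply: continuous_scale_cst => {}x; apply: cvgM; first exact: cvg_cst.
      by apply: cvgB; [exact: phic|exact: cvg_cst].
    by apply/funext => x; rewrite /f/= scalerA.
  - by move=> n x _; apply: lM; exists (n%:R *: ((phi x - t) *: z)).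
  - move=> x _; rewrite indicE (_ : (x \in B) = (0 < phi x - t)); first exact: lim.
    by rewrite subr_gt0; apply/idP/idP; rewrite inE.
  (* [f n] has the form [l (sigma (A x + b))] with [A x = (n * phi x) *: z] and
     [b = - (n * t) *: z]. *)
  - move=> n; have [An Anc AnE] : exists2 An : {linear X -> X}, continuous An &
        forall x, An x = (n%:R * phi x) *: z.
      have [g gc gE] := continuous_scalar_lincomb n%:R 0 phic phic.
      have [An Anc AnE] := continuous_rank1 z gc.
      by exists An => // x; rewrite AnE gE mul0r addr0.
    apply: eq_same_integral (munu (- (n%:R * t) *: z) lc Anc) => x _.
    by rewrite AnE -scalerDl -mulrBr -scalerA.
have fin (m : {finite_measure set (borel X) -> \bar R}) : m (B `&` K) \is a fin_num.
  by rewrite fin_num_measure//; exact: measurableI.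
move: sB; rewrite /same_integral /Rintegral !integral_indic// => BKE.
by rewrite setIC -[LHS]fineK ?fin// BKE fineK ?fin.
Qed.

End annihilation.

Theorem theorem2p8 (R : realType) (X : tvsType R) (p : nat -> X -> R)
    (hX : frechet_seminorms p)
    (sigma : X -> X)
    (sigma_cont : continuous sigma)
    (sigma_bounded : von_neumann_bounded p (range sigma))
    (sigma_sep : separating sigma)
    (K : set X) (K_compact : compact K)
    (mu : {charge set (borel X) -> \bar R})
    (mu_regular : regular_charge_on K mu)
    (mu_annihilates :
      forall (ell : {scalar X}) (A : {linear X -> X}) (b : X),
        continuous ell -> continuous A ->
        charge_integral mu K (fun x => ell (sigma (A x + b))) = 0) :
  forall E : set (borel X), measurable E -> mu E = 0%E.
Proof.
have hausX := frechet_hausdorff hX; have [muK mureg] := mu_regular.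
have mK : measurable (K : set (borel X)) by exact: compact_borel_measurable.
have same (ell : {scalar X}) (A : {linear X -> X}) (b : X) :
    continuous ell -> continuous A ->
    same_integral (charge_pos mu) (charge_neg mu) K
      (fun x => ell (sigma (A x + b))).
  by move=> ellc Ac; apply/subr0_eq; exact: mu_annihilates.
move=> E mE; rewrite muK//.
have mEK : measurable (E `&` K) by exact: measurableI.
(* By the Jordan decomposition [mu] is the difference of these two finite values. *)
suff PN : charge_pos mu (E `&` K) = charge_neg mu (E `&` K).
  rewrite (jordan_decomp (svalP (hahn_sig mu)) mEK) /cadd/= cscaleN1.
  rewrite -/(charge_pos mu) -/(charge_neg mu) PN subee// fin_num_measure//.
(* The dominating measure is the total variation, which is the sum of the Jordan parts. *)
apply: (regular_eq hausX K_compact _ (dual_halfspaces_separate hX) _ mureg) => //.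
- apply: halfspace_sigma_measurable => f; exact: dual_functions_measurable.
- move=> A GA; apply: (exponential_determining_halfspaces mK _ _ _ _ _ GA).
  + by move=> f; exact: dual_functions_bounded.
  + exact: dual_functionsD.
  + exact: dual_functionsZ.
  + move=> _ [l lc <-]; apply: eq_on_rays_integral_expR => //.
      exact: continuous_borel_measurable.
    by move=> t; exact: (annihilated_rays hX sigma_cont sigma_bounded sigma_sep mK same).
  + exact: dual_functions_measurable.
  + have [l [_ [lc _]]] := separating_heaviside hX sigma_sep.
    by exists l, l.
Qed.
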